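(* Let $X$ be a real Hilbert space, $U:X\to X$ a nonexpansive mapping, $C\subseteq X$ a bounded closed convex set such that $U$ maps $C$ into itself, and $v_0\in C$. For each $n\in\mathbb{N}$ let $U_n(x):=\left(1-\frac{1}{n+1}\right)U(x)+\frac{1}{n+1}v_0$ and let $u_n$ be the unique fixed point of the strict contraction $U_n$. Let $b\in\mathbb{N}$, $b\geq 1$, be an upper bound on the diameter of $C$. Then, for all $k\in\mathbb{N}$ and every monotone function $f:\mathbb{N}\to\mathbb{N}$, $$\exists N\leq \phi_b(k,f)\ \forall i,j\in[N,f(N)]\ \left(\|u_i-u_j\|<\frac{1}{k+1}\right),$$ where $$\phi_b(k,f):=12b^2\left(h^{(R)}(0)+1\right)^2+b,$$ with $R:=64b^4(k+1)^4+b^2$ and $h(m):=\max\{8b(f(12b^2(m+1)^2+b)+1)(k+1)^2,\ 12b(m+1)^2\}+1$.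
   Context: $\mathbb{N}=\{0,1,2,\ldots\}$. For $n,m\in\mathbb{N}$, $[n,m]:=\{n,n+1,\ldots,m\}$ (empty if $m<n$). A map $U$ is nonexpansive if $\|U(x)-U(y)\|\leq\|x-y\|$ for all $x,y$. A function $f:\mathbb{N}\to\mathbb{N}$ is monotone if $k\leq n$ implies $f(k)\leq f(n)$. $h^{(R)}$ denotes the $R$-fold composition of $h$ with itself. *)

(* Defs.v *)
From HB Require Import structures.
From mathcomp Require Import all_boot all_order all_algebra.
From mathcomp Require Import all_classical all_reals all_analysis.
Import Order.TTheory GRing.Theory Num.Theory.
Import numFieldNormedType.Exports.

Set Implicit Arguments.
Unset Strict Implicit.
Unset Printing Implicit Defensive.

Local Open Scope classical_set_scope.
Local Open Scope ring_scope.

(* [{dot X for idfun}] is the type of symmetric positive definite bilinear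
   forms; completeness is that of [X] for the norm induced by [inner]. *)
HB.mixin Record CompleteNormedModule_isHilbert (R : realType) X
    of CompleteNormedModule R X := {
  inner : {dot X for (@idfun R)};
  sqr_normE : forall x : X, `|x| ^+ 2 = inner x x
}.

#[short(type="hilbertType")]
HB.structure Definition Hilbert (R : realType) :=
  { X of CompleteNormedModule R X & CompleteNormedModule_isHilbert R X }.

Definition nonexpansive (R : realType) (X : normedModType R) (U : X -> X) :=
  forall x y : X, `|U x - U y| <= `|x - y|.

Definition diam (R : realType) (X : normedModType R) (C : set X) : \bar R :=
  ereal_sup [set z | exists x y, [/\ C x, C y & z = `|x - y|%:E]].

(* The map $U_n$. *)
Definition anchored (R : realType) (X : normedModType R)
    (U : X -> X) (v0 : X) (n : nat) (x : X) : X :=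
  (1 - 1 / (n%:R + 1)) *: U x + (1 / (n%:R + 1)) *: v0.

Local Open Scope nat_scope.

Definition hstep (b k : nat) (f : nat -> nat) (m : nat) : nat :=
  maxn (8 * b * (f (12 * b ^ 2 * (m + 1) ^ 2 + b) + 1) * (k + 1) ^ 2)
       (12 * b * (m + 1) ^ 2) + 1.

Definition phi (b k : nat) (f : nat -> nat) : nat :=
  let r := 64 * b ^ 4 * (k + 1) ^ 4 + b ^ 2 in
  12 * b ^ 2 * (iter r (hstep b k f) 0 + 1) ^ 2 + b.

(* Main.v *)
Require Import Defs.
From HB Require Import structures.
From mathcomp Require Import all_boot all_order all_algebra.
From mathcomp Require Import all_classical all_reals all_analysis.
From mathcomp Require Import ring lra zify.
Import Order.TTheory GRing.Theory Num.Theory.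
Import numFieldNormedType.Exports.

(* Halpern's argument. For [n <= m], nonexpansiveness applied to the fixed
   points gives [|u_n - u_m|^2 <= |u_m - v0|^2 - |u_n - v0|^2]. Hence
   [|u_n - v0|^2] is a nondecreasing sequence in [0, b^2], so it cannot increase
   by [1/(k+1)^2] along each of the first [b^2 (k+1)^2 + 1] iterates of [f]
   starting at 0. One of these iterates is the required [N], and it lies below
   [phi b k f], because [f <= hstep b k f] and [b^2 (k+1)^2] is at most the
   number of iterations occurring in [phi]. *)

Set Implicit Arguments.
Unset Strict Implicit.
Unset Printing Implicit Defensive.

Local Open Scope classical_set_scope.
Local Open Scope ring_scope.

Section Hilbert.
Context {R : realType} {X : hilbertType R}.
Implicit Types x y : X.

Lemma sqr_norm_scaleB x y (a c : R) :
  `|a *: x - c *: y| ^+ 2 =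
  a ^+ 2 * `|x| ^+ 2 + c ^+ 2 * `|y| ^+ 2 - 2 * a * c * inner x y.
Proof.
rewrite !sqr_normE linearBl !linearBr !linearZl_LR !linearZr_LR /=.
by rewrite (hermC _ y x) /= expr0 mul1r -![_ *: _]/(_ * _); ring.
Qed.

(** Squaring the hypothesis and dropping [|a *: x - c *: y| ^+ 2] leaves a|x|^2 + c|y|^2 <= (a +
    c)<x,y>. As c >= 0 and |y|^2 >= 2<x,y> - |x|^2, it follows that (a - c)|x|^2 <= (a - c)<x,y>.
    Cancelling a - c > 0 gives |x|^2 <= <x,y>, which is the conclusion expanded. *)
Lemma le_sqr_normB x y (a c : R) : 0 <= c -> c < a ->
  `|(1 + a) *: x - (1 + c) *: y| <= `|x - y| ->
  `|x - y| ^+ 2 <= `|y| ^+ 2 - `|x| ^+ 2.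
Proof.
move=> c0 ca /(lerXn2r 2)-/(_ (normr_ge0 _) (normr_ge0 _)).
have := sqr_ge0 `|a *: x - c *: y|; have := sqr_ge0 `|x - y|.
have -> : x - y = 1 *: x - 1 *: y by rewrite !scale1r.
rewrite !sqr_norm_scaleB; nra.
Qed.

End Hilbert.

Lemma contraction_factor (R : realFieldType) (n : nat) :
  0 <= (1 - 1 / (n%:R + 1) : R) < 1.
Proof.
have n1 : 0 < n%:R + 1 :> R by rewrite ltr_wpDl.
by rewrite subr_ge0 gtrBl divr_gt0// andbT ler_pdivrMr// mul1r lerDr.
Qed.

Section Anchored.
Context {R : realType} {X : normedModType R} (U : X -> X) (v0 : X).

Lemma anchored0 x : anchored U v0 0 x = v0.
Proof. by rewrite /anchored add0r divr1 subrr scale0r add0r scale1r. Qed.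

(** The fixed point equation reads x - v0 = n/(n+1) (U x - v0), and 1 + 1/n inverts the factor. *)
Lemma anchored_fixedE n x : (0 < n)%N -> anchored U v0 n x = x ->
  U x - v0 = (1 + n%:R^-1) *: (x - v0).
Proof.
move=> n0 xE; have nR : 0 < n%:R :> R by rewrite ltr0n.
have <- : (1 - 1 / (n%:R + 1)) *: (U x - v0) = x - v0 :> X.
  rewrite scalerBr -[in RHS]xE /anchored -addrA; congr (_ + _).
  by rewrite scalerBl scale1r opprB.
rewrite scalerA [X in X *: _](_ : _ = 1) ?scale1r//.
by field; rewrite !gt_eqF ?ltr_wpDl.
Qed.

Hypothesis U_nonexpansive : nonexpansive U.

Lemma anchored_lipschitz n x y :
  `|anchored U v0 n x - anchored U v0 n y| <=
  (1 - 1 / (n%:R + 1)) * `|x - y|.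
Proof.
have /andP[s1 _] := contraction_factor R n.
rewrite /anchored [X in `|X|](_ : _ = (1 - 1 / (n%:R + 1)) *: (U x - U y)).
  by rewrite normrZ ger0_norm// ler_wpM2l.
by rewrite scalerBr opprD addrACA subrr addr0.
Qed.

Context (C : set X).
Hypotheses (C_convex : convex_set C) (U_stable : U @` C `<=` C) (v0_in_C : C v0).

Lemma anchored_stable n x : C x -> C (anchored U v0 n x).
Proof.
move=> Cx; have /andP[q0 /ltW q1] := contraction_factor R n.
have UC : C (U x) by apply: U_stable; exists x.
have := @C_convex (U x) v0 (Itv01 q0 q1); rewrite !inE => /(_ UC v0_in_C).
by rewrite /conv/= /anchored /unstable.onem subKr.
Qed.

(** The Picard iterates [y j] from [v0] stay in [C] and approach [x] at rate [q ^+ j], so |x - v0|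
    <= q^j |x - v0| + b for every j; let j tend to infinity. *)
Lemma norm_anchored_fixedB n x (b : R) :
    (forall y z, C y -> C z -> `|y - z| <= b) ->
  anchored U v0 n x = x -> `|x - v0| <= b.
Proof.
move=> diamC xE; set q : R := 1 - 1 / (n%:R + 1).
have /andP[q0 q1] : 0 <= q < 1 := contraction_factor R n.
pose y j := iter j (anchored U v0 n) v0.
have yC j : C (y j) by elim: j => // j ?; exact: anchored_stable.
have xy j : `|x - y j| <= q ^+ j * `|x - v0|.
  elim: j => [|j IH]; first by rewrite mul1r.
  rewrite -[x in `|x - _|]xE (le_trans (anchored_lipschitz _ _ _))// exprS -mulrA.
  by rewrite ler_wpM2l.
have cvgb : (fun j => q ^+ j * `|x - v0| + b) @ \oo --> (0 * `|x - v0| + b).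
  apply: cvgD; last exact: cvg_cst.
  by apply: cvgM; [apply: cvg_expr; rewrite ger0_norm|exact: cvg_cst].
rewrite mul0r add0r in cvgb; rewrite -(cvg_lim _ cvgb)//.
apply: limr_ge; first by apply/cvg_ex; exists b.
apply: nearW => j; rewrite (le_trans (ler_distD (y j) _ _))// lerD//.
exact: diamC.
Qed.

End Anchored.

Lemma halpern_le (R : realType) (X : hilbertType R) (U : X -> X) (v0 : X)
    (u : nat -> X) : nonexpansive U -> (forall n, anchored U v0 n (u n) = u n) ->
  forall n m, (n <= m)%N ->
    `|u n - u m| ^+ 2 <= `|u m - v0| ^+ 2 - `|u n - v0| ^+ 2.
Proof.
move=> U_nonexpansive uE n m; rewrite leq_eqVlt => /predU1P[->|nm].
  by rewrite !subrr normr0 expr0n.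
(* The factor 1 + 1/n requires n > 0; for n = 0, [u 0] is [v0] and equality holds. *)
have [n0|n0] := posnP n.
  by rewrite n0 -(uE 0%N) anchored0 subrr normr0 expr0n subr0 distrC.
have m0 : (0 < m)%N by exact: leq_trans nm.
have -> : u n - u m = (u n - v0) - (u m - v0) by rewrite opprB addrA subrK.
(* With these coefficients the scaled vectors are U u_n - v0 and U u_m - v0, so the last premise is
   nonexpansiveness. *)
apply: (@le_sqr_normB _ _ _ _ n%:R^-1 m%:R^-1).
- by rewrite invr_ge0.
- by rewrite ltf_pV2 ?posrE ?ltr0n// ltr_nat.
- rewrite -!(anchored_fixedE _ (uE _))// [in leLHS]opprB addrA subrK.
  by rewrite [in leRHS]opprB addrA subrK.
Qed.

(** Induction on [r]: if the value at iterate r is at least r eps, the next increment is less than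
    (r + 1) eps - r eps. *)
Lemma iter_small_increment (R : realDomainType) (a : nat -> R) (f : nat -> nat)
    (eps : R) (r : nat) : 0 <= a 0%N -> a (iter r f 0%N) < r%:R * eps ->
  exists2 i, (i < r)%N & a (f (iter i f 0%N)) - a (iter i f 0%N) < eps.
Proof.
move=> a0; elim: r => [|r IH]; first by rewrite mul0r ltNge a0.
have [/IH[i ir ai] _|ar /=] := ltP (a (iter r f 0%N)) (r%:R * eps).
  by exists i => //; exact: ltnW.
by rewrite -natr1 mulrDl mul1r => afr; exists r => //; lra.
Qed.

Lemma leq_iter2 (f h : nat -> nat) : {homo f : m n / (m <= n)%N} ->
    (forall m, (f m <= h m)%N) ->
  forall i r, (i <= r)%N -> (iter i f 0 <= iter r h 0)%N.
Proof.
move=> fhomo fh i r; elim: r i => [|r IH] [|i]//= ir.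
by rewrite (leq_trans _ (fh _))// fhomo// IH.
Qed.

Lemma leq_f_hstep b k f m : (0 < b)%N -> {homo f : m n / (m <= n)%N} ->
  (f m <= hstep b k f m)%N.
Proof.
move=> b0 /(_ m (12 * b ^ 2 * (m + 1) ^ 2 + b)%N) fm.
by have := fm ltac:(nia); rewrite /hstep; nia.
Qed.

Theorem theorem5p3 (R : realType) (X : hilbertType R) (U : X -> X)
    (C : set X) (v0 : X) (u : nat -> X) (b : nat)
    (U_nonexpansive : nonexpansive U)
    (C_bounded : bounded_set C) (C_closed : closed C) (C_convex : convex_set C)
    (U_stable : U @` C `<=` C) (v0_in_C : C v0)
    (u_fixed : forall n : nat,
       unique (fun x : X => anchored U v0 n x = x) (u n))
    (b_ge1 : (1 <= b)%N) (C_diam : (diam C <= b%:R%:E)%E)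
    (k : nat) (f : nat -> nat) (f_monotone : {homo f : m n / (m <= n)%N}) :
  exists2 N : nat, (N <= phi b k f)%N &
    forall i j : nat, (N <= i <= f N)%N -> (N <= j <= f N)%N ->
      `|u i - u j| < 1 / (k%:R + 1).
Proof.
have uE n : anchored U v0 n (u n) = u n by case: (u_fixed n).
have halpern := halpern_le U_nonexpansive uE.
have diamC y z : C y -> C z -> `|y - z| <= b%:R.
  move=> Cy Cz; rewrite -lee_fin (le_trans _ C_diam)//.
  by apply: ereal_sup_ubound; exists y, z.
have ub n : `|u n - v0| <= b%:R.
  exact: (norm_anchored_fixedB U_nonexpansive C_convex U_stable v0_in_C diamC (uE n)).
pose a n := `|u n - v0| ^+ 2; pose eps : R := (1 / (k%:R + 1)) ^+ 2.
have a_le n : a n <= b%:R ^+ 2 by rewrite lerXn2r// nnegrE.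
have a_homo n m : (n <= m)%N -> a n <= a m.
  by move=> /halpern; rewrite -[a n <= _]subr_ge0; exact: le_trans (sqr_ge0 _).
(* Since b^2 = b^2 (k+1)^2 eps, the extra iterate makes the bound on [a] strict. *)
have [i ir ai] : exists2 i, (i < b ^ 2 * (k + 1) ^ 2 + 1)%N &
    a (f (iter i f 0%N)) - a (iter i f 0%N) < eps.
  apply: iter_small_increment; first exact: sqr_ge0.
  apply: (le_lt_trans (a_le _)); rewrite natrD natrM !natrX natrD mulrDl mul1r.
  have k0 : 0 < k%:R + 1 :> R by rewrite ltr_wpDl.
  have -> : b%:R ^+ 2 * (k%:R + 1) ^+ 2 * eps = b%:R ^+ 2.
    by rewrite /eps; field; rewrite gt_eqF.
  by rewrite ltrDl exprn_gt0// divr_gt0.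
exists (iter i f 0%N).
  have := @leq_iter2 f (hstep b k f) f_monotone
    (fun m => leq_f_hstep k m b_ge1 f_monotone) i (64 * b ^ 4 * (k + 1) ^ 4 + b ^ 2)%N.
  by rewrite /phi => /(_ ltac:(nia)); nia.
move=> n m; wlog nm : n m / (n <= m)%N => [hw Hn Hm|].
  by case/orP: (leq_total n m) => ?; [|rewrite distrC]; exact: hw.
move=> /andP[Nn _] /andP[_ mf].
have k0 : 0 <= 1 / (k%:R + 1) :> R by rewrite divr_ge0// addr_ge0.
rewrite -(ltr_pXn2r (n := 2))// ?nnegrE//.
(* As N <= n <= m <= f N, the increment of [a] from n to m is at most that from N to f N. *)
apply: le_lt_trans (halpern _ _ nm) (le_lt_trans _ ai).
by apply: lerB; exact: a_homo.
Qed.
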